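(* Assume that $\bar s\neq 0$, $\mathrm{val}\,\mathrm{P}(\bar s)\in\mathbb{R}$, $\nu$ is lower semi-continuous at $\bar s$ and $\mathrm{Sol}\,\mathrm{D}(\bar s)\neq\emptyset$. Then $\mathrm{Sol}\,\mathrm{D}(\bar s)$ is unbounded with $$-\bar s\in[\mathrm{Sol}\,\mathrm{D}(\bar s)]^{\infty}.$$
   Context: Standing setting: $\mathcal{Y}$ is a finite dimensional Hilbert space, $K\subset\mathcal{Y}$ is a nonempty closed convex set, $f:\mathbb{R}^n\to\mathbb{R}$ is convex and continuously differentiable, $g:\mathbb{R}^n\to\mathcal{Y}$ is continuously differentiable, and $G_K(x)=-g(x)+K$ is graph-convex, i.e. $\{(x,s)\in\mathbb{R}^n\times\mathcal{Y}: g(x)+s\in K\}$ is convex. $\mathcal{S}=\{s\in\mathcal{Y}:\exists x\in\mathbb{R}^n,\ g(x)+s\in K\}$ is assumed closed with $0\notin\mathcal{S}$, and $\bar s=\mathrm{argmin}\{\frac12\|s\|^2: s\in\mathcal{S}\}$ is the projection of $0$ onto $\mathcal{S}$. For $s\in\mathcal{Y}$, $\mathrm{P}(s)$ is the problem $\min f(x)$ s.t. $g(x)+s\in K$, with optimal value $\mathrm{val}\,\mathrm{P}(s)=\nu(s)=\inf\{f(x): g(x)+s\in K\}$ (with $\inf\emptyset=+\infty$). The dual function is $\theta(\lambda)=-\inf_{x\in\mathbb{R}^n,\,y\in K}[f(x)+\langle\lambda,g(x)-y\rangle]$. $\mathrm{D}(s)$ is the dual problem $\max_{\lambda\in\mathcal{Y}}[\langle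 s,\lambda\rangle-\theta(\lambda)]$, and $\mathrm{Sol}\,\mathrm{D}(s)$ is its set of optimal solutions. $C^\infty$ denotes the recession cone of a closed convex set $C$. *)

(* Defs.v *)
From HB Require Import structures.
From mathcomp Require Import all_boot all_order all_algebra.
From mathcomp Require Import all_classical all_reals all_analysis.

Set Implicit Arguments.
Unset Strict Implicit.
Unset Printing Implicit Defensive.

Import Order.TTheory GRing.Theory Num.Theory.
Import numFieldNormedType.Exports.

Local Open Scope classical_set_scope.
Local Open Scope ring_scope.

Definition finite_dimensional (R : realType) (Y : normedModType R) : Prop :=
  exists (k : nat) (e : 'I_k -> Y),
    forall y : Y, exists c : 'I_k -> R, y = \sum_i c i *: e i.

(* The library has no inner product spaces: a real Hilbert space is a normed
   module with a positive definite symmetric bilinear form inducing its norm.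
   Completeness is automatic in finite dimension. *)
Definition finite_dim_hilbert (R : realType) (Y : normedModType R)
    (dot : {dot Y for @idfun R}) : Prop :=
  finite_dimensional Y /\ forall y : Y, `|y| ^+ 2 = dot y y.

(* The second clause is continuity of x |-> 'd f x for the operator norm. *)
Definition continuously_differentiable (R : realType) (V W : normedModType R)
    (f : V -> W) : Prop :=
  (forall x, differentiable f x) /\
  (forall (x : V) (e : R), 0 < e ->
     \forall x' \near x, forall v : V, `|'d f x' v - 'd f x v| <= e * `|v|).

(* Pointwise form of the library's lower_semicontinuous. *)
Definition lower_semicontinuous_at (R : realType) (X : topologicalType)
    (h : X -> \bar R) (x : X) : Prop :=
  forall a : R, (a%:E < h x)%E -> \forall x' \near x, (a%:E < h x')%E.

Definition is_argmin (R : realType) (T : Type) (h : T -> R) (A : set T)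
    (x : T) : Prop :=
  A x /\ forall x', A x' -> h x <= h x'.

Definition recession_cone (R : realType) (Y : lmodType R) (C : set Y) : set Y :=
  [set d | forall (c : Y) (t : R), C c -> 0 <= t -> C (c + t *: d)].

Section shifted_problems.
Context (R : realType) (n : nat) (Y : normedModType R).
Context (dot : {dot Y for @idfun R}).
Context (f : 'rV[R]_n -> R) (g : 'rV[R]_n -> Y) (K : set Y).

(* Graph of the set-valued map x |-> - g x + K. *)
Definition constraint_graph : set ('rV[R]_n * Y) :=
  [set p | K (g p.1 + p.2)].

Definition feasible (s : Y) : set 'rV[R]_n := [set x | K (g x + s)].

Definition feasible_shifts : set Y := [set s | exists x, K (g x + s)].

(* ereal_inf set0 = +oo, so an infeasible problem has value +oo. *)
Definition value (s : Y) : \bar R :=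
  ereal_inf [set (f x)%:E | x in feasible s].

Definition dual_function (lambda : Y) : \bar R :=
  (- ereal_inf [set (f x + dot lambda (g x - y))%:E | x in setT & y in K])%E.

Definition dual_objective (s lambda : Y) : \bar R :=
  ((dot s lambda)%:E - dual_function lambda)%E.

(* An optimal solution must be feasible, i.e. lie in the domain of
   dual_function: there are none when the objective is identically -oo. *)
Definition dual_solutions (s : Y) : set Y :=
  [set lambda | (dual_function lambda < +oo)%E /\
     forall mu, (dual_objective s mu <= dual_objective s lambda)%E].

End shifted_problems.

(* Main.v *)
Require Import Defs.
From mathcomp Require Import all_boot all_order all_algebra.
From mathcomp Require Import all_classical all_reals all_analysis.
From mathcomp Require Import lra.
Import Order.TTheory GRing.Theory Num.Theory.
Import numFieldNormedType.Exports.
Local Open Scope classical_set_scope.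
Local Open Scope ring_scope.

(** Write [S] for the set of feasible shifts.  Each pair [x], [y \in K] in the
    infimum defining [- dual_function lambda] gives a shift [s = y - g x] in
    [S], and the term attached to it is [f x - dot lambda s].  Moving [lambda]
    to [lambda - t *: sbar] with [0 <= t] therefore adds [t * dot sbar s] to
    every term.  Since [S] is convex and [sbar] is its element of least norm,
    [S] lies in the half-space [dot sbar s >= `|sbar| ^+ 2]
    ([argmin_norm_halfspace]), so the dual function decreases by at least
    [t * `|sbar| ^+ 2] ([dual_function_le_halfspace]).  The linear part of the
    dual objective at [sbar] decreases by exactly that amount.  Hence the
    objective does not decrease along [- sbar], and a dual solution stays one:
    [- sbar] is a recession direction of the solution set.  As it is nonzero
    and the solution set is nonempty, that set contains a half-line and is
    unbounded ([recession_unbounded]). *)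

Lemma dotC {R : realType} {Y : lmodType R} (dot : {dot Y for @idfun R})
  (u v : Y) : dot u v = dot v u.
Proof. by rewrite hermC expr0 mul1r. Qed.

(** The variational inequality of the projection of the origin: otherwise the
    segment from [p] to [s] would start by descending towards the origin and
    so contain points of [A] of norm smaller than that of [p]. *)
Lemma argmin_norm_halfspace {R : realType} {Y : normedModType R}
    (dot : {dot Y for @idfun R}) (dotE : forall y : Y, `|y| ^+ 2 = dot y y)
    (A : set Y) (p : Y) :
  @convex_set R Y A -> is_argmin (fun s : Y => 2^-1 * `|s| ^+ 2) A p ->
  forall s, A s -> `|p| ^+ 2 <= dot p s.
Proof.
move=> cvxA [Ap min_p] s As.
pose d := dot p (s - p); pose q := `|s - p| ^+ 2 : R.
suff : 0 <= d by rewrite /d linearBr /= subr_ge0 dotE.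
have q_ge0 : 0 <= q by exact: sqr_ge0.
rewrite leNgt; apply/negP => d_lt0.
have qd_gt0 : 0 < q - d by lra.
(* The squared norm at [p + a *: (s - p)] exceeds that at [p] by
   [a * (2 * d + a * q)]; this [a] keeps [a * q] at most [- d], which makes the
   bracket negative, and it stays in ]0, 1] even when [q = 0]. *)
have [a [a_gt0 a_le1 aq]] : exists a : R, [/\ 0 < a, a <= 1 & a * (q - d) = - d].
  exists (- d / (q - d)); split; last by rewrite divfK ?gt_eqF.
    by apply: divr_gt0; lra.
  by rewrite ler_pdivrMr; lra.
have Aps : A (p + a *: (s - p)).
  have -> : p + a *: (s - p) = a *: s + (1 - a) *: p.
    by rewrite scalerBr scalerBl scale1r addrCA.
  have := cvxA s p (Itv01 (ltW a_gt0) a_le1).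
  by rewrite !inE; apply.
have := min_p _ Aps; rewrite ler_pM2l ?invr_gt0 ?ltr0n // !dotE.
rewrite linearDl linearDr /= linearDr /= !linearZl_LR /= !linearZr_LR /=.
rewrite [dot (s - p) p]dotC -/d -[dot (s - p) _]dotE -/q.
rewrite /GRing.scale /= => le_pp.
have : 0 <= a * (2 * d + a * q) by lra.
by rewrite pmulr_rge0 //; nra.
Qed.

(** [feasible_shifts g K] is the projection of [constraint_graph g K] on its
    second factor. *)
Lemma feasible_shifts_convex {R : realType} {n : nat} {Y : normedModType R}
    (g : 'rV[R]_n -> Y) (K : set Y) :
  @convex_set R ('rV[R]_n * Y)%type (constraint_graph g K) ->
  @convex_set R Y (feasible_shifts g K).
Proof.
move=> cvxG s1 s2 a; rewrite !inE => -[x1 Kx1] [x2 Kx2].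
have := cvxG (x1, s1) (x2, s2) a; rewrite !inE => /(_ Kx1 Kx2) Kx.
by exists (a%:num *: x1 + (1 - a%:num) *: x2).
Qed.

(** The bound holds term by term in the infimum, as
    [f x + dot lambda (g x - y)] is affine in [lambda] with slope minus the
    shift [y - g x]. *)
Lemma dual_function_le_halfspace {R : realType} {n : nat}
    {Y : normedModType R} (dot : {dot Y for @idfun R})
    (f : 'rV[R]_n -> R) (g : 'rV[R]_n -> Y) (K : set Y) (d : Y) (c : R) :
  (forall s, feasible_shifts g K s -> c <= dot d s) ->
  forall (lambda : Y) (t : R), 0 <= t ->
  (dual_function dot f g K (lambda - t *: d)%R
     <= dual_function dot f g K lambda - (t * c)%:E)%E.
Proof.
move=> half lambda t t_ge0; rewrite /dual_function -oppeD; last first.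
  by rewrite fin_num_adde_defl.
rewrite leeN2; apply: le_ereal_inf_tmp => _ [x _ [y Ky <-]].
rewrite -leeBrDr//.
apply: (@le_trans _ _ (f x + dot lambda (g x - y))%:E).
  by apply: ereal_inf_lbound; exists x => //; exists y.
have Sy : feasible_shifts g K (y - g x) by exists x; rewrite subrKC.
have := ler_wpM2l t_ge0 (half _ Sy).
rewrite -EFinB lee_fin linearBl /= linearZl_LR /= -[g x - y]opprB !linearNr /=.
lra.
Qed.

Lemma recession_unbounded {R : realType} {V : normedModType R}
    (C : set V) (d : V) :
  C !=set0 -> d != 0 -> recession_cone C d -> ~ bounded_set C.
Proof.
move=> [c Cc] d_neq0 recd bndC.
have := globally_properfilter Cc => filterC.
have [M CM] := (ex_bound _).1 bndC.
have nd_gt0 : 0 < `|d| by rewrite normr_gt0.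
pose t := (`|M| + `|c| + 1) / `|d|.
have t_ge0 : 0 <= t by rewrite divr_ge0 // !addr_ge0.
have /= := CM _ (recd c t Cc t_ge0).
have := lerB_normD (t *: d) c.
rewrite [t *: d + c]addrC normrZ ger0_norm // divfK ?gt_eqF // => le1 le2.
have := ler_norm M; lra.
Qed.

Theorem proposition4p2 (R : realType) (n : nat) (Y : normedModType R)
  (dot : {dot Y for @idfun R})
  (f : 'rV[R]_n -> R) (g : 'rV[R]_n -> Y) (K : set Y) (sbar : Y)
  (hY : finite_dim_hilbert dot)
  (K_neq0 : K !=set0) (K_closed : closed K) (K_convex : @convex_set R Y K)
  (f_convex : @convex_function R 'rV[R]_n setT f)
  (f_C1 : continuously_differentiable (f : 'rV[R]_n -> R^o))
  (g_C1 : continuously_differentiable g)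
  (graph_convex : @convex_set R ('rV[R]_n * Y)%type (constraint_graph g K))
  (S_closed : closed (feasible_shifts g K))
  (S_not0 : ~ feasible_shifts g K 0)
  (sbar_argmin :
     is_argmin (fun s : Y => 2^-1 * `|s| ^+ 2) (feasible_shifts g K) sbar)
  (sbar_neq0 : sbar != 0)
  (value_fin : value f g K sbar \is a fin_num)
  (value_lsc : lower_semicontinuous_at (value f g K) sbar)
  (sol_neq0 : dual_solutions dot f g K sbar !=set0) :
  ~ bounded_set (dual_solutions dot f g K sbar) /\
  recession_cone (dual_solutions dot f g K sbar) (- sbar).
Proof.
have [_ dotE] := hY.
have half := argmin_norm_halfspace dot dotE _ _
  (feasible_shifts_convex _ _ graph_convex) sbar_argmin.
suff rec : recession_cone (dual_solutions dot f g K sbar) (- sbar).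
  by split=> //; apply: recession_unbounded rec; rewrite ?oppr_eq0.
move=> lambda t [fin_lambda max_lambda] t_ge0; rewrite scalerN.
have le_dual := dual_function_le_halfspace dot f g K _ _ half lambda t t_ge0.
split.
  exact: le_lt_trans le_dual (lte_add_pinfty fin_lambda (ltry _)).
move=> mu; apply: le_trans (max_lambda mu) _.
rewrite /dual_objective linearBr /= linearZr_LR /= -dotE.
(* Against this upper bound for the dual function, the change of the linear
   part cancels. *)
apply: (@le_trans _ _ ((dot sbar lambda - t * `|sbar| ^+ 2)%:E
    - (dual_function dot f g K lambda - (t * `|sbar| ^+ 2)%:E))%E); last first.
  by rewrite leeD2lE // leeN2.
case: (dual_function _ _ _ _ lambda) => [r||] //=.
by rewrite -!EFinB lee_fin; lra.
Qed.
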